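(* Consider the approximate one-block MCMC algorithm with delayed acceptance (ABDA), with target density $\pi(\boldsymbol{x},\boldsymbol{\theta}\mid\boldsymbol{b})$ and approximate density $\hat\pi(\boldsymbol{x},\boldsymbol{\theta}\mid\boldsymbol{b})$. Let $(\boldsymbol{x},\boldsymbol{\theta})$ be the current state of the chain and let $(\boldsymbol{x}',\boldsymbol{\theta}')$ be the proposed state promoted to the second stage. Then the second-stage acceptance ratio $$\rho_3(\boldsymbol{x}',\boldsymbol{\theta}';\boldsymbol{x},\boldsymbol{\theta})=\min\left\{1,\frac{\pi(\boldsymbol{x}',\boldsymbol{\theta}'\mid\boldsymbol{b})\,q(\boldsymbol{x},\boldsymbol{\theta}\mid\boldsymbol{x}',\boldsymbol{\theta}')}{\pi(\boldsymbol{x},\boldsymbol{\theta}\mid\boldsymbol{b})\,q(\boldsymbol{x}',\boldsymbol{\theta}'\mid\boldsymbol{x},\boldsymbol{\theta})}\right\}$$ equals $$\rho_3(\boldsymbol{x}',\boldsymbol{\theta}';\boldsymbol{x},\boldsymbol{\theta})=\min\left\{1,\frac{w(\boldsymbol{x}',\boldsymbol{\theta}')}{w(\boldsymbol{x},\boldsymbol{\theta})}\right\}.$$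
   Context: Let $\boldsymbol{A}\in\mathbb{R}^{M\times N}$, $\boldsymbol{b}\in\mathbb{R}^M$, let $\boldsymbol{\Gamma}_{\rm prior}\in\mathbb{R}^{N\times N}$ be symmetric positive definite, and let $\boldsymbol{\theta}=(\mu,\sigma)\in(0,\infty)^2$. The hyperprior density is $\pi(\boldsymbol{\theta})\propto\mu^{\alpha_\mu-1}\sigma^{\alpha_\sigma-1}\exp(-\beta_\mu\mu-\beta_\sigma\sigma)$ with $\alpha_\mu,\alpha_\sigma,\beta_\mu,\beta_\sigma>0$. The joint posterior density on $\mathbb{R}^N\times(0,\infty)^2$ is $$\pi(\boldsymbol{x},\boldsymbol{\theta}\mid\boldsymbol{b})\propto\mu^{M/2}\sigma^{N/2}\pi(\boldsymbol{\theta})\exp\left(-\tfrac{\mu}{2}\|\boldsymbol{A}\boldsymbol{x}-\boldsymbol{b}\|_2^2-\tfrac{\sigma}{2}\boldsymbol{x}^\top\boldsymbol{\Gamma}_{\rm prior}^{-1}\boldsymbol{x}\right).$$ Put $\boldsymbol{\Gamma}_{\rm cond}^{-1}(\boldsymbol{\theta})=\mu\boldsymbol{A}^\top\boldsymbol{A}+\sigma\boldsymbol{\Gamma}_{\rm prior}^{-1}$. For each $\boldsymbol{\theta}$ let $\widehat{\boldsymbol{\Gamma}}_{\rm cond}(\boldsymbol{\theta})$ be a symmetric positive definite $N\times N$ matrix (an approximation of $\boldsymbol{\Gamma}_{\rm cond}(\boldsymbol{\theta})$) and put $\hat{\boldsymbol{x}}_{\rm cond}(\boldsymbol{\theta})=\mu\widehat{\boldsymbol{\Gamma}}_{\rm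 cond}(\boldsymbol{\theta})\boldsymbol{A}^\top\boldsymbol{b}$. The approximate posterior density is $$\hat\pi(\boldsymbol{x},\boldsymbol{\theta}\mid\boldsymbol{b})\propto\mu^{M/2}\sigma^{N/2}\pi(\boldsymbol{\theta})\exp\left(-\tfrac{\mu}{2}\boldsymbol{b}^\top\boldsymbol{b}+\tfrac{\mu^2}{2}\boldsymbol{b}^\top\boldsymbol{A}\widehat{\boldsymbol{\Gamma}}_{\rm cond}(\boldsymbol{\theta})\boldsymbol{A}^\top\boldsymbol{b}-\tfrac12(\boldsymbol{x}-\hat{\boldsymbol{x}}_{\rm cond}(\boldsymbol{\theta}))^\top\widehat{\boldsymbol{\Gamma}}_{\rm cond}^{-1}(\boldsymbol{\theta})(\boldsymbol{x}-\hat{\boldsymbol{x}}_{\rm cond}(\boldsymbol{\theta}))\right).$$ Its marginal is $\hat\pi(\boldsymbol{\theta}\mid\boldsymbol{b})=\int_{\mathbb{R}^N}\hat\pi(\boldsymbol{x},\boldsymbol{\theta}\mid\boldsymbol{b})\,d\boldsymbol{x}$ and its conditional $\hat\pi(\boldsymbol{x}\mid\boldsymbol{\theta},\boldsymbol{b})=\hat\pi(\boldsymbol{x},\boldsymbol{\theta}\mid\boldsymbol{b})/\hat\pi(\boldsymbol{\theta}\mid\boldsymbol{b})$ is the density of $\mathcal{N}(\hat{\boldsymbol{x}}_{\rm cond}(\boldsymbol{\theta}),\widehat{\boldsymbol{\Gamma}}_{\rm cond}(\boldsymbol{\theta}))$. Only ratios of $\hat\pi(\boldsymbol{x},\boldsymbol{\theta}\mid\boldsymbol{b})$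 or of $\hat\pi(\boldsymbol{\theta}\mid\boldsymbol{b})$ at two states are used, so a common normalizing constant is immaterial. For each $\boldsymbol{\theta}$, $r(\cdot\mid\boldsymbol{\theta})$ is a proposal probability density on $(0,\infty)^2$. Define $$w(\boldsymbol{x},\boldsymbol{\theta})=\exp\left(-\tfrac12\boldsymbol{x}^\top\big(\boldsymbol{\Gamma}_{\rm cond}^{-1}(\boldsymbol{\theta})-\widehat{\boldsymbol{\Gamma}}_{\rm cond}^{-1}(\boldsymbol{\theta})\big)\boldsymbol{x}\right).$$ ABDA, one step from $(\boldsymbol{x},\boldsymbol{\theta})$. Stage 1: draw $\boldsymbol{\theta}_*\sim r(\cdot\mid\boldsymbol{\theta})$, then $\boldsymbol{x}_*\sim\hat\pi(\cdot\mid\boldsymbol{\theta}_*,\boldsymbol{b})$; promote $(\boldsymbol{x}',\boldsymbol{\theta}')=(\boldsymbol{x}_*,\boldsymbol{\theta}_* )$ with probability $\hat\rho_1(\boldsymbol{\theta}_*;\boldsymbol{\theta})$, and otherwise promote $(\boldsymbol{x}',\boldsymbol{\theta}')=(\boldsymbol{x},\boldsymbol{\theta})$, where $$\hat\rho_1(\boldsymbol{\theta}';\boldsymbol{\theta})=\min\left\{1,\frac{\hat\pi(\boldsymbol{\theta}'\mid\boldsymbol{b})\,r(\boldsymbol{\theta}\mid\boldsymbol{\theta}')}{\hat\pi(\boldsymbol{\theta}\mid\boldsymbol{b})\,r(\boldsymbol{\theta}'\mid\boldsymbol{\theta})}\right\}.$$ Stage 2: accept $(\boldsymbol{x}',\boldsymbol{\theta}')$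 with probability $\rho_3(\boldsymbol{x}',\boldsymbol{\theta}';\boldsymbol{x},\boldsymbol{\theta})$, otherwise stay at $(\boldsymbol{x},\boldsymbol{\theta})$. Here $q$ is the effective Stage 1 transition $$q(\boldsymbol{x}',\boldsymbol{\theta}'\mid\boldsymbol{x},\boldsymbol{\theta})=\hat\rho_1(\boldsymbol{\theta}';\boldsymbol{\theta})\,\hat\pi(\boldsymbol{x}'\mid\boldsymbol{\theta}',\boldsymbol{b})\,r(\boldsymbol{\theta}'\mid\boldsymbol{\theta})+\delta_{(\boldsymbol{x},\boldsymbol{\theta})}(\boldsymbol{x}',\boldsymbol{\theta}')\,(1-y(\boldsymbol{\theta})),$$ with $y(\boldsymbol{\theta})=\iint\hat\rho_1(\boldsymbol{\theta}';\boldsymbol{\theta})\hat\pi(\boldsymbol{x}'\mid\boldsymbol{\theta}',\boldsymbol{b})r(\boldsymbol{\theta}'\mid\boldsymbol{\theta})\,d\boldsymbol{x}'\,d\boldsymbol{\theta}'$ and $\delta$ the Dirac mass. Thus for $(\boldsymbol{x}',\boldsymbol{\theta}')\neq(\boldsymbol{x},\boldsymbol{\theta})$, $q(\boldsymbol{x}',\boldsymbol{\theta}'\mid\boldsymbol{x},\boldsymbol{\theta})$ is just the first term; when the promoted state equals the current state, $\rho_3=1$ by convention. A promoted state $(\boldsymbol{x}',\boldsymbol{\theta}')\ne(\boldsymbol{x},\boldsymbol{\theta})$ satisfies $q(\boldsymbol{x}',\boldsymbol{\theta}'\mid\boldsymbol{x},\boldsymbol{\theta})>0$, i.e. $r(\boldsymbol{\theta}'\mid\boldsymbol{\theta})>0$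 and $r(\boldsymbol{\theta}\mid\boldsymbol{\theta}')>0$. *)

(* Defs.v *)
From mathcomp Require Import all_boot all_order all_algebra.
From mathcomp Require Import all_classical all_reals all_analysis.

Set Implicit Arguments.
Unset Strict Implicit.
Unset Printing Implicit Defensive.

Import Order.TTheory GRing.Theory Num.Theory.
Import numFieldNormedType.Exports.

Local Open Scope classical_set_scope.
Local Open Scope ring_scope.

Section LinearAlgebra.
Context {R : realType}.

Definition qform n (P : 'M[R]_n) (x : 'cV[R]_n) : R := (x^T *m P *m x) 0 0.

Definition spd n (P : 'M[R]_n) : Prop :=
  P^T = P /\ forall x : 'cV[R]_n, x != 0 -> 0 < qform P x.

(* Squared Euclidean norm; the library norm `|x| on matrices is the max norm. *)
Definition sqnorm2 n (x : 'cV[R]_n) : R := \sum_(i < n) x i 0 ^+ 2.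

(* Lebesgue integral over R^n, written as n nested one-dimensional Lebesgue
   integrals. By Tonelli's theorem this is the integral against n-dimensional
   Lebesgue measure for every nonnegative Borel function; it is applied below
   only to nonnegative functions that are continuous on R^n. *)
Fixpoint integralRn (n : nat) : ('cV[R]_n -> \bar R) -> \bar R :=
  match n with
  | 0 => fun f => f 0
  | n'.+1 => fun f =>
      (\int[@lebesgue_measure R]_t
         integralRn (fun x : 'cV[R]_n' => f (col_mx (t%:M : 'cV[R]_1) x)))%E
  end.

(* The parameter space (0, oo)^2. *)
Definition quadrant : set (R * R) := [set t | 0 < t.1 /\ 0 < t.2].

Definition prob_density_on_quadrant (f : R * R -> R) : Prop :=
  [/\ measurable_fun quadrant f,
      (forall t, quadrant t -> 0 <= f t)
    & (\int[@lebesgue_measure R \x @lebesgue_measure R]_(t in quadrant)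
         (f t)%:E = 1)%E].

End LinearAlgebra.

(* The data of the problem and of the sampler. The fields c_hyper, c_post and
   c_apost are the constants hidden in the three proportionality signs;
   prop_dens t' t is r(t' | t). *)
Record abda_model (R : realType) (M N : nat) := AbdaModel {
  fwd         : 'M[R]_(M, N);
  obs         : 'cV[R]_M;
  cov_prior   : 'M[R]_N;
  alpha_mu    : R;
  alpha_sigma : R;
  beta_mu     : R;
  beta_sigma  : R;
  c_hyper     : R;
  c_post      : R;
  c_apost     : R;
  cov_hat     : R * R -> 'M[R]_N;
  prop_dens   : R * R -> R * R -> R
}.

Section ABDA.
Context {R : realType} {M N : nat} (m : abda_model R M N).

Local Notation A := (fwd m).
Local Notation b := (obs m).
Local Notation r := (prop_dens m).
Local Notation param := (R * R)%type.
Local Notation state := ('cV[R]_N * (R * R))%type.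

Definition hyperprior (t : param) : R :=
  let: (mu, sigma) := t in
  c_hyper m * (mu `^ (alpha_mu m - 1)) * (sigma `^ (alpha_sigma m - 1))
    * expR (- beta_mu m * mu - beta_sigma m * sigma).

Definition posterior (s : state) : R :=
  let: (x, t) := s in let: (mu, sigma) := t in
  c_post m * (mu `^ (M%:R / 2)) * (sigma `^ (N%:R / 2)) * hyperprior t
    * expR (- (mu / 2) * sqnorm2 (A *m x - b)
            - (sigma / 2) * qform (invmx (cov_prior m)) x).

Definition prec_cond (t : param) : 'M[R]_N :=
  let: (mu, sigma) := t in
  mu *: (A^T *m A) + sigma *: invmx (cov_prior m).

Definition mean_hat (t : param) : 'cV[R]_N :=
  t.1 *: (cov_hat m t *m A^T *m b).

Definition approx_posterior (s : state) : R :=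
  let: (x, t) := s in let: (mu, sigma) := t in
  c_apost m * (mu `^ (M%:R / 2)) * (sigma `^ (N%:R / 2)) * hyperprior t
    * expR (- (mu / 2) * (b^T *m b) 0 0
            + (mu ^+ 2 / 2) * (b^T *m A *m cov_hat m t *m A^T *m b) 0 0
            - 2^-1 * qform (invmx (cov_hat m t)) (x - mean_hat t)).

Definition approx_marginal (t : param) : R :=
  fine (integralRn (fun x => (approx_posterior (x, t))%:E)).

Definition approx_conditional (x : 'cV[R]_N) (t : param) : R :=
  approx_posterior (x, t) / approx_marginal t.

Definition rho1_hat (t' t : param) : R :=
  Num.min 1 ((approx_marginal t' * r t t') / (approx_marginal t * r t' t)).

Definition move_density (s' s : state) : R :=
  let: (x', t') := s' in let: (x, t) := s in
  rho1_hat t' t * approx_conditional x' t' * r t' t.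

Definition move_prob (s : state) : R :=
  fine (\int[@lebesgue_measure R \x @lebesgue_measure R]_(t' in quadrant)
          integralRn (fun x' => (move_density (x', t') s)%:E))%E.

(* q(s' | s). The Dirac mass at s is rendered by its weight on the single point
   s', i.e. the indicator of s' = s; for s' <> s only the first term remains. *)
Definition stage1_transition (s' s : state) : R :=
  move_density s' s + \1_[set s] s' * (1 - move_prob s).

Definition rho3 (s' s : state) : R :=
  if s' == s then 1
  else Num.min 1 ((posterior s' * stage1_transition s s')
                  / (posterior s * stage1_transition s' s)).

Definition weight (s : state) : R :=
  let: (x, t) := s in
  expR (- 2^-1 * qform (prec_cond t - invmx (cov_hat m t)) x).

(* s' is the current state s, or a new state with q(s' | s) > 0: since the
   approximate posterior and its marginal are positive, the latter amounts to
   positivity of the proposal density in both directions. *)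
Definition promotable (s s' : state) : Prop :=
  s' <> s -> 0 < r s'.2 s.2 /\ 0 < r s.2 s'.2.

End ABDA.

(* Main.v *)
(* Stage 1 is a Metropolis-Hastings move for the approximate posterior, so its
   move density is in detailed balance with that density. Completing the square
   in x shows that posterior / approximate posterior is a constant times the
   weight w; hence the Stage 2 ratio collapses to a ratio of weights. The
   divisions are licit because the marginal of the approximate posterior is
   finite and positive: the nested Gaussian integral is computed one variable at
   a time through Schur complements. *)

Require Import Defs.
From mathcomp Require Import all_boot all_order all_algebra.
From mathcomp Require Import all_classical all_reals all_analysis.
From mathcomp Require Import measurable_realfun ring.

Import Order.TTheory GRing.Theory Num.Theory.
Import numFieldNormedType.Exports.

Local Open Scope classical_set_scope.
Local Open Scope ring_scope.

Section QuadraticForms.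
Context {R : realType}.

Lemma trmx_mx11 (a : 'M[R]_1) : a^T = a.
Proof. by apply/matrixP => i j; rewrite !ord1 mxE. Qed.

Lemma sqnorm2E {n} (y : 'cV[R]_n) : sqnorm2 y = (y^T *m y) 0 0.
Proof. by rewrite mxE; apply: eq_bigr => i _; rewrite mxE expr2. Qed.

Lemma spd_unitmx {n} {P : 'M[R]_n} : spd P -> P \in unitmx.
Proof.
move=> [symP posP]; rewrite unitmxE unitfE; apply/negP => /det0P[v v0 vP].
have vT0 : v^T != 0 by rewrite -trmx0 (inj_eq trmx_inj).
by have := posP _ vT0; rewrite /qform trmxK vP mul0mx mxE ltxx.
Qed.

Lemma spd_invmx {n} {P : 'M[R]_n} : spd P -> spd (invmx P).
Proof.
move=> spdP; have uP := spd_unitmx spdP; case: spdP => symP posP.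
split=> [|x x0]; first by rewrite trmx_inv symP.
(* The form of [P] at [invmx P *m x] is the form of [invmx P] at [x]. *)
have y0 : invmx P *m x != 0.
  by apply: contra x0 => /eqP y0; rewrite -(mulKVmx uP x) y0 mulmx0.
have := posP _ y0.
by rewrite /qform trmx_mul trmx_inv symP !mulmxA mulmxKV.
Qed.

Lemma spd_drsubmx {n} {P : 'M[R]_(1 + n)} : spd P -> spd (drsubmx P).
Proof.
move=> [symP posP]; split=> [|x x0]; first by rewrite trmx_drsub symP.
have x0' : col_mx (0 : 'cV[R]_1) x != 0.
  by apply: contra x0; rewrite col_mx_eq0 => /andP[].
have := posP _ x0'.
rewrite /qform -{1}(submxK P) tr_col_mx trmx0 mul_row_block mul_row_col.
by rewrite mulmx0 mul0mx !add0r.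
Qed.

(** Meant for symmetric [P], whose upper-right block is the transpose of [dlsubmx P]. *)
Definition schur_compl {n} (P : 'M[R]_(1 + n)) : R :=
  ulsubmx P 0 0 - qform (invmx (drsubmx P)) (dlsubmx P).

(** The square is completed in [z], not in [t]: for a fixed outer variable [t], what remains is a
    translate of the form of [drsubmx P]. *)
Lemma qform_col_mx {n} (P : 'M[R]_(1 + n)) (t : R) (z : 'cV[R]_n) :
    P^T = P -> drsubmx P \in unitmx ->
  qform P (col_mx t%:M z)
  = schur_compl P * t ^+ 2
    + qform (drsubmx P) (z + t *: (invmx (drsubmx P) *m dlsubmx P)).
Proof.
move=> symP uP; rewrite /schur_compl /qform -{1}(submxK P) -[ursubmx P]trmxK.
rewrite trmx_ursub symP.
have: (drsubmx P)^T = drsubmx P by rewrite trmx_drsub symP.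
move: uP; move: (ulsubmx P) (dlsubmx P) (drsubmx P) => a v Q uQ symQ.
rewrite tr_col_mx tr_scalar_mx mul_row_block mul_row_col.
rewrite [(z + _)^T]linearD /= [(t *: _)^T]linearZ /= trmx_mul trmx_inv symQ.
rewrite !mul_scalar_mx !mul_mx_scalar !mulmxDl !mulmxDr -!scalemxAl -!scalemxAr.
rewrite -!mulmxA (mulKVmx uQ) (mulKmx uQ).
move: (z^T *m v) (v^T *m z) (z^T *m (Q *m z)) => p q s.
by rewrite !mxE; ring.
Qed.

Lemma schur_compl_gt0 {n} {P : 'M[R]_(1 + n)} : spd P -> 0 < schur_compl P.
Proof.
move=> spdP; have uQ := spd_unitmx (spd_drsubmx spdP); case: spdP => symP posP.
(* This [w] cancels the translation at [t = 1], so the form takes the value [schur_compl P] at a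
   nonzero vector. *)
pose w := - (1 *: (invmx (drsubmx P) *m dlsubmx P)).
have x0 : col_mx (1%:M : 'cV[R]_1) w != 0.
  by rewrite col_mx_eq0 negb_and oner_neq0.
have := posP _ x0; rewrite qform_col_mx// /w addNr.
by rewrite /qform mulmx0 mxE addr0 expr1n mulr1.
Qed.

End QuadraticForms.

Section GaussianIntegral.
Context {R : realType}.

(** The integrand is a multiple of the normal density with mean [m] and variance [s^-1], which has
    total mass 1. *)
Lemma integral_gauss1 {s : R} (c m : R) : 0 < s -> 0 <= c ->
  (\int[@lebesgue_measure R]_t (c * expR (- 2^-1 * (s * (t - m) ^+ 2)))%:E
   = (c * (normal_peak (Num.sqrt s^-1))^-1)%:E)%E.
Proof.
move=> s0 c0; pose sg := Num.sqrt s^-1.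
have sg0 : sg != 0 by rewrite gt_eqF// sqrtr_gt0 invr_gt0.
have p0 := normal_peak_gt0 sg0.
transitivity (\int[@lebesgue_measure R]_t
    ((c * (normal_peak sg)^-1)%:E * (normal_pdf m sg t)%:E))%E.
  apply: eq_integral => t _; rewrite -EFinM; congr EFin.
  rewrite normal_pdfE// /normal_fun -!mulrA mulKf ?gt_eqF//.
  rewrite sqr_sqrtr ?invr_ge0 ?ltW//; congr (_ * expR _).
  by field; rewrite gt_eqF.
rewrite ge0_integralZl_EFin//.
- by rewrite integral_normal_pdf mule1.
- by move=> t _; rewrite lee_fin normal_pdf_ge0.
- by apply/measurable_EFinP; exact: measurable_normal_pdf.
- by rewrite mulr_ge0// invr_ge0 ltW.
Qed.

(* Completing the square in the outermost variable leaves, inside, a Gaussian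
   whose mean depends on that variable but whose integral does not: hence the
   uniformity in [m]. *)
Lemma integralRn_gauss {n} {P : 'M[R]_n} : spd P ->
  exists2 K : R, 0 < K & forall (c : R) (m : 'cV[R]_n), 0 <= c ->
    integralRn (fun x => (c * expR (- 2^-1 * qform P (x - m)))%:E) = (c * K)%:E.
Proof.
elim: n P => [|n IHn] P spdP.
  exists 1 => // c m _ /=.
  by rewrite (flatmx0 (_ - _)) /qform mulmx0 mxE mulr0 expR0.
have [K K0 IK] := IHn _ (spd_drsubmx (spdP : @spd R (1 + n) P)).
have s0 := schur_compl_gt0 (spdP : @spd R (1 + n) P).
have sg0 : Num.sqrt (@schur_compl R n P)^-1 != 0.
  by rewrite gt_eqF// sqrtr_gt0 invr_gt0.
exists (K * (normal_peak (Num.sqrt (@schur_compl R n P)^-1))^-1).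
  by rewrite mulr_gt0// invr_gt0 normal_peak_gt0.
move=> c m c0 /=; pose m1 := @usubmx R 1 n 1 m; pose m2 := @dsubmx R 1 n 1 m.
(* The closed form is turned back into an integral over the outermost coordinate, so that only
   integrands remain to be compared. *)
rewrite mulrA -(integral_gauss1 _ (m1 0 0) s0) ?mulr_ge0 ?(ltW K0)//.
apply: eq_integral => t _.
pose w := invmx (@drsubmx R 1 n 1 n P) *m @dlsubmx R 1 n 1 n P.
(* For fixed [t] the other coordinates have conditional mean [m2 - (t - m1 0 0) *: w]; the
   exponential in [t] joins the constant of the induction hypothesis. *)
rewrite mulrAC -(IK _ (m2 - (t - m1 0 0) *: w)) ?mulr_ge0 ?expR_ge0//.
congr integralRn; apply/funext => x; rewrite -mulrA -expRD -mulrDr.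
congr ((c * expR (_ * _))%:E).
have -> : col_mx (t%:M : 'cV[R]_1) x - m = col_mx (t - m1 0 0)%:M (x - m2).
  rewrite raddfB /= -(mx11_scalar m1).
  by rewrite -add_col_mx -opp_col_mx (@vsubmxK R 1 n 1 m).
rewrite qform_col_mx ?(spd_unitmx (spd_drsubmx _))//; last by case: spdP.
by rewrite opprB addrA addrAC.
Qed.

End GaussianIntegral.

Section ABDA.
Context {R : realType} {M N : nat} {m : abda_model R M N}.
Hypotheses (c_hyper_gt0 : 0 < c_hyper m) (c_apost_gt0 : 0 < c_apost m).
Hypothesis (spd_hat : forall t, quadrant t -> spd (cov_hat m t)).

Local Notation A := (fwd m).
Local Notation b := (obs m).
Local Notation r := (prop_dens m).

(** The factor of the approximate posterior that is free of [x]. *)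
Definition gauss_factor (t : R * R) : R :=
  c_apost m * (t.1 `^ (M%:R / 2)) * (t.2 `^ (N%:R / 2)) * hyperprior m t
    * expR (- (t.1 / 2) * (b^T *m b) 0 0
            + (t.1 ^+ 2 / 2) * (b^T *m A *m cov_hat m t *m A^T *m b) 0 0).

Lemma gauss_factor_gt0 {t : R * R} : quadrant t -> 0 < gauss_factor t.
Proof.
case: t => mu sigma [/= mu0 sigma0]; rewrite /gauss_factor /hyperprior /=.
by rewrite !mulr_gt0 ?powR_gt0 ?expR_gt0.
Qed.

Lemma approx_posterior_gaussE (x : 'cV[R]_N) (t : R * R) :
  approx_posterior m (x, t)
  = gauss_factor t
    * expR (- 2^-1 * qform (invmx (cov_hat m t)) (x - mean_hat m t)).
Proof.
by case: t => mu sigma; rewrite /gauss_factor /= -[RHS]mulrA -expRD [- 2^-1 * _]mulNr.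
Qed.

Lemma approx_posterior_gt0 (x : 'cV[R]_N) {t : R * R} :
  quadrant t -> 0 < approx_posterior m (x, t).
Proof.
by move=> qt; rewrite approx_posterior_gaussE mulr_gt0 ?gauss_factor_gt0 ?expR_gt0.
Qed.

Lemma approx_marginal_gt0 {t : R * R} : quadrant t -> 0 < approx_marginal m t.
Proof.
move=> qt; have [K K0 IK] := integralRn_gauss (spd_invmx (spd_hat _ qt)).
rewrite /approx_marginal.
under eq_fun do rewrite approx_posterior_gaussE.
by rewrite IK ?(ltW (gauss_factor_gt0 qt))//= mulr_gt0 ?gauss_factor_gt0.
Qed.

(** Since [invmx (cov_hat m t)] sends [mean_hat m t] to [t.1 *: (A^T *m b)], the two exponents agree
    in degrees 0 and 1 in [x]; their quadratic parts differ by the exponent of [weight]. *)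
Lemma posterior_approxE (x : 'cV[R]_N) {t : R * R} : quadrant t ->
  posterior m (x, t)
  = c_post m / c_apost m * weight m (x, t) * approx_posterior m (x, t).
Proof.
move=> qt; have uG := spd_unitmx (spd_hat _ qt); have [symG _] := spd_hat _ qt.
case: t qt uG symG => mu sigma qt uG symG.
rewrite /posterior /weight /approx_posterior.
move: (hyperprior m _) (mu `^ _) (sigma `^ _) => h pm ps.
set e := (X in _ = _ * expR _ * (_ * X)).
set e1 := expR _; set e2 := expR _.
have -> : e1 = e2 * e.
  rewrite /e1 /e2 /e -expRD; congr expR.
  rewrite sqnorm2E /qform /mean_hat /prec_cond /=.
  move: uG symG; move: (cov_hat m _) => G uG symG.
  rewrite ![(_ - _)^T]raddfB /= [(_ *: _)^T]linearZ /= !trmx_mul trmxK symG.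
  rewrite !(mulmxBl, mulmxBr, mulmxDl, mulmxDr, mulNmx, mulmxN).
  rewrite -!(scalemxAl, scalemxAr) ?mulNmx -?(scalemxAl, scalemxAr) -!mulmxA.
  rewrite !(mulKVmx uG, mulKmx uG).
  (* A 1-by-1 product equals its transpose; identifying these two leaves six scalar atoms for
     [field]. *)
  have -> : x^T *m (A^T *m b) = b^T *m (A *m x).
    by rewrite -[LHS]trmx_mx11 !trmx_mul !trmxK mulmxA.
  move: (x^T *m _) (x^T *m _) (x^T *m _) (b^T *m b) (b^T *m _) (b^T *m _).
  by move=> p1 p2 p3 p4 p5 p6; rewrite !mxE; field.
by field; rewrite gt_eqF.
Qed.

(** Once the denominator is cleared, the minimum is symmetric in [t] and [t']: this is the source of
    detailed balance. *)
Lemma mulr_rho1_hat {t t' : R * R} :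
    quadrant t -> quadrant t' -> 0 < r t' t ->
  approx_marginal m t * r t' t * rho1_hat m t' t
  = Num.min (approx_marginal m t * r t' t) (approx_marginal m t' * r t t').
Proof.
move=> qt qt' r0; have a0 := approx_marginal_gt0 qt.
have ar0 : 0 < approx_marginal m t * r t' t by rewrite mulr_gt0.
by rewrite /rho1_hat minr_pMr ?ltW// mulr1 [X in Num.min _ X]mulrC divfK// gt_eqF.
Qed.

Lemma move_density_balance (x x' : 'cV[R]_N) {t t' : R * R} :
    quadrant t -> quadrant t' -> 0 < r t' t -> 0 < r t t' ->
  approx_posterior m (x', t') * move_density m (x, t) (x', t')
  = approx_posterior m (x, t) * move_density m (x', t') (x, t).
Proof.
move=> qt qt' r0 r0'; have := mulr_rho1_hat qt qt' r0.
have := mulr_rho1_hat qt' qt r0'; rewrite minC => <-.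
have := approx_marginal_gt0 qt; have := approx_marginal_gt0 qt'.
rewrite /move_density /approx_conditional => a0' a0 E.
(* Both sides are one symmetric prefactor times the two expressions that [E] equates. *)
transitivity (approx_posterior m (x, t) * approx_posterior m (x', t')
    / (approx_marginal m t * approx_marginal m t')
    * (approx_marginal m t' * r t t' * rho1_hat m t t')).
  by field; rewrite !gt_eqF.
by rewrite -E; field; rewrite !gt_eqF.
Qed.

Lemma move_density_gt0 (x x' : 'cV[R]_N) {t t' : R * R} :
    quadrant t -> quadrant t' -> 0 < r t' t -> 0 < r t t' ->
  0 < move_density m (x', t') (x, t).
Proof.
move=> qt qt' r0 r0'; have a0 := approx_marginal_gt0 qt.
have a0' := approx_marginal_gt0 qt'.
rewrite /move_density /approx_conditional /rho1_hat mulr_gt0// mulr_gt0//.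
  by rewrite lt_min ltr01 divr_gt0// mulr_gt0.
by rewrite divr_gt0// approx_posterior_gt0.
Qed.

Lemma stage1_transition_neq (s s' : 'cV[R]_N * (R * R)) :
  s' <> s -> stage1_transition m s' s = move_density m s' s.
Proof.
by move=> new; rewrite /stage1_transition indicE memNset// mul0r addr0.
Qed.

End ABDA.

Theorem proposition2 (R : realType) (M N : nat) (m : abda_model R M N)
  (spd_prior : spd (cov_prior m))
  (alpha_mu_gt0 : 0 < alpha_mu m) (alpha_sigma_gt0 : 0 < alpha_sigma m)
  (beta_mu_gt0 : 0 < beta_mu m) (beta_sigma_gt0 : 0 < beta_sigma m)
  (c_hyper_gt0 : 0 < c_hyper m) (c_post_gt0 : 0 < c_post m)
  (c_apost_gt0 : 0 < c_apost m)
  (spd_hat : forall t, quadrant t -> spd (cov_hat m t))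
  (r_density : forall t, quadrant t ->
     prob_density_on_quadrant (fun t' => prop_dens m t' t))
  (x x' : 'cV[R]_N) (theta theta' : R * R)
  (theta_pos : quadrant theta) (theta'_pos : quadrant theta')
  (promoted : promotable m (x, theta) (x', theta')) :
  rho3 m (x', theta') (x, theta)
    = Num.min 1 (weight m (x', theta') / weight m (x, theta)).
Proof.
have w0 : 0 < weight m (x, theta) by exact: expR_gt0.
rewrite /rho3; case: eqP => [[-> ->]|new]; first by rewrite divff ?minxx// gt_eqF.
have [r0 r0'] := promoted new.
have balance := move_density_balance c_hyper_gt0 c_apost_gt0 spd_hat
  x x' theta_pos theta'_pos r0 r0'.
have q0 := move_density_gt0 c_hyper_gt0 c_apost_gt0 spd_hat
  x x' theta_pos theta'_pos r0 r0'.
have p0 := approx_posterior_gt0 c_hyper_gt0 c_apost_gt0 x theta_pos.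
rewrite !stage1_transition_neq//; last by move/esym.
rewrite (posterior_approxE c_apost_gt0 spd_hat x theta_pos).
rewrite (posterior_approxE c_apost_gt0 spd_hat x' theta'_pos).
(* Balance gives numerator and denominator the same factor [approx_posterior * move_density], which
   cancels together with the normalizing constants. *)
rewrite -[_ * move_density _ _ _]mulrA balance.
by congr Num.min; field; rewrite !gt_eqF.
Qed.
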